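(* Let $V$ be a finite set with $|V|\geq 3$. Then for every Boolean sublattice $\mathcal{B}$ of $\mathrm{Part}(V)$ of largest size among all Boolean sublattices of $\mathrm{Part}(V)$ there is a semi-interval system $(V,\mathcal{I})$ such that $\mathcal{B}=\mathcal{D}(V,\mathcal{I})$.
   Context: $\mathrm{Part}(V)$ is the lattice of all partitions of $V$ ordered by refinement. A Boolean sublattice is a sublattice (closed under meet and join of $\mathrm{Part}(V)$) that is itself a Boolean lattice. A closure system $(V,\mathcal{Q})$ is a family $\mathcal{Q}\subseteq\wp(V)$ containing $V$ and closed under arbitrary intersections. A semi-interval system is a closure system $(V,\mathcal{I})$ satisfying: (I$_0$) $\emptyset\in\mathcal{I}$ and $\{x\}\in\mathcal{I}$ for all $x\in V$; (I$_1$) if $A,B\in\mathcal{I}$ and $A\cap B\neq\emptyset$, then $A\cup B\in\mathcal{I}$. $\mathcal{D}(V,\mathcal{I})$ is the set of all partitions of $V$ all of whose blocks belong to $\mathcal{I}$, ordered by refinement. *)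

(* Defs.v *)
From HB Require Import structures.
From mathcomp Require Import all_boot all_order.

Set Implicit Arguments.
Unset Strict Implicit.
Unset Printing Implicit Defensive.

Local Open Scope order_scope.

(* Part(T): the partitions of the whole of T (nonempty, disjoint, covering
   blocks), as a type of its own, so that it can carry the refinement order. *)
Record part (T : finType) : Type :=
  Part { blocks : {set {set T}}; _ : partition blocks [set: T] }.

HB.instance Definition _ (T : finType) := [isSub for @blocks T].
HB.instance Definition _ (T : finType) := [Finite of part T by <:].

Section PartLattice.
Variable T : finType.
Implicit Types (P Q R : part T) (A B : {set T}) (x y : T).

Definition refines P Q : bool :=
  [forall A in blocks P, exists B in blocks Q, A \subset B].

Definition same_block P : rel T := fun x y => y \in pblock (blocks P) x.

Fact same_block_equiv P : equivalence_rel (same_block P).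
Proof.
have /and3P[/eqP covP triP _] := valP P.
move=> x y z; have cx u : u \in cover (blocks P) by rewrite covP inE.
rewrite /same_block mem_pblock cx; split=> //.
by move=> /(same_pblock triP) ->.
Qed.

Fact refinesP P Q :
  reflect (forall x y, same_block P x y -> same_block Q x y) (refines P Q).
Proof.
have /and3P[/eqP covP triP P0] := valP P.
have /and3P[/eqP covQ triQ Q0] := valP Q.
have cP u : u \in cover (blocks P) by rewrite covP inE.
have cQ u : u \in cover (blocks Q) by rewrite covQ inE.
rewrite /same_block; apply: (iffP forall_inP) => [sPQ x y Pxy | sPQ A PA].
  have /exists_inP[B QB sAB] := sPQ _ (pblock_mem (cP x)).
  have Bx : x \in B by rewrite (subsetP sAB) // mem_pblock.
  by rewrite (def_pblock triQ QB Bx) (subsetP sAB).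
have /set0Pn[x Ax] : A != set0 by apply: contraNneq P0 => <-.
apply/exists_inP; exists (pblock (blocks Q) x); first exact: pblock_mem.
by apply/subsetP=> y Ay; apply: sPQ; rewrite (def_pblock triP PA Ax).
Qed.

Fact refines_refl : reflexive refines.
Proof. by move=> P; apply/refinesP. Qed.

Fact refines_trans : transitive refines.
Proof.
move=> Q P R /refinesP sPQ /refinesP sQR.
by apply/refinesP=> x y /sPQ/sQR.
Qed.

Fact refines_anti : antisymmetric refines.
Proof.
move=> P Q /andP[/refinesP sPQ /refinesP sQP]; apply: val_inj => /=.
have eqPQ x : pblock (blocks P) x = pblock (blocks Q) x.
  by apply/setP=> y; apply/idP/idP=> [/sPQ|/sQP].
suff sub P1 Q1 : (forall x, pblock (blocks P1) x = pblock (blocks Q1) x) ->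
    blocks P1 \subset blocks Q1.
  by apply/eqP; rewrite eqEsubset !sub // => x; rewrite eqPQ.
move=> eqPQ1; apply/subsetP=> A PA.
have /and3P[_ triP P0] := valP P1; have /and3P[/eqP covQ _ _] := valP Q1.
have /set0Pn[x Ax] : A != set0 by apply: contraNneq P0 => <-.
by rewrite -(def_pblock triP PA Ax) eqPQ1 pblock_mem // covQ inE.
Qed.

HB.instance Definition _ := Order.Le_isPOrder.Build
  (Order.Disp tt tt) (part T) refines_refl refines_anti refines_trans.

(* The partition into the classes of an equivalence relation. *)
Definition classes_of (e : rel T) (eqv_e : equivalence_rel e) : part T :=
  Part (equivalence_partitionP (D := [set: T]) (in3W eqv_e)).

Fact same_block_classes (e : rel T) (eqv_e : equivalence_rel e) :
  same_block (classes_of eqv_e) =2 e.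
Proof.
move=> x y; rewrite /same_block /=.
by rewrite pblock_equivalence_partition ?inE //; apply: in3W.
Qed.

Definition meet_rel P Q : rel T :=
  fun x y => same_block P x y && same_block Q x y.

Fact meet_rel_equiv P Q : equivalence_rel (meet_rel P Q).
Proof.
move=> x y z; rewrite /meet_rel.
have [-> eqP] := same_block_equiv P x y z.
have [-> eqQ] := same_block_equiv Q x y z.
by split=> // /andP[/eqP-> /eqQ->].
Qed.

(* The transitive closure of the union of the two equivalences. *)
Definition join_rel P Q : rel T :=
  connect (fun x y => same_block P x y || same_block Q x y).

Fact same_block_sym P : symmetric (same_block P).
Proof.
have /equivalence_relP[Pxx Ptr] := same_block_equiv P.
by move=> x y; apply/idP/idP=> /Ptr <-; apply: Pxx.
Qed.

Fact join_rel_equiv P Q : equivalence_rel (join_rel P Q).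
Proof.
apply/equivalence_relP; split=> [x|]; first exact: connect0.
apply: sym_left_transitive; last exact: connect_trans.
by apply: sym_connect_sym => x y; rewrite same_block_sym (same_block_sym Q).
Qed.

Definition part_meet P Q : part T := classes_of (meet_rel_equiv P Q).
Definition part_join P Q : part T := classes_of (join_rel_equiv P Q).

Fact part_meetP P Q R : (P <= part_meet Q R) = (P <= Q) && (P <= R).
Proof.
apply/refinesP/andP=> [sPQR | [/refinesP sPQ /refinesP sPR] x y Pxy].
  by split; apply/refinesP=> x y /sPQR; rewrite same_block_classes => /andP[].
by rewrite same_block_classes /meet_rel sPQ ?sPR.
Qed.

Fact part_joinP P Q R : (part_join P Q <= R) = (P <= R) && (Q <= R).
Proof.
apply/refinesP/andP=> [sPQR | [/refinesP sPR /refinesP sQR] x y].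
  by split; apply/refinesP=> x y xy; apply: sPQR;
     rewrite same_block_classes; apply: connect1; rewrite xy ?orbT.
rewrite same_block_classes => /connectP[p].
elim: p x => [|z p IHp] x /= => [_ -> | /andP[xz pz] /(IHp _ pz)].
  by have [] := same_block_equiv R x x x.
have Rxz : same_block R x z by case/orP: xz => [/sPR|/sQR].
by have [_ /(_ Rxz)->] := same_block_equiv R x z y.
Qed.

HB.instance Definition _ := Order.POrder_MeetJoin_isLattice.Build
  (Order.Disp tt tt) (part T) part_meetP part_joinP.

End PartLattice.

(* The bounds of a Boolean sublattice need not be those of Part(T). *)
Definition boolean_sublattice (T : finType) (B : {set part T}) : Prop :=
  [/\ {in B &, forall P Q, P `&` Q \in B},
      {in B &, forall P Q, P `|` Q \in B},
      {in B & &, forall P Q R, P `&` (Q `|` R) = (P `&` Q) `|` (P `&` R)}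
    & exists bot top : part T,
      [/\ bot \in B, top \in B, {in B, forall P, bot <= P <= top}
        & {in B, forall P, exists2 Q, Q \in B & P `&` Q = bot /\ P `|` Q = top}]].

Definition largest_boolean_sublattice (T : finType) (B : {set part T}) : Prop :=
  boolean_sublattice B /\
  forall B' : {set part T}, boolean_sublattice B' -> (#|B'| <= #|B|)%N.

(* The instance F = set0 of the second clause also yields [set: T] \in C. *)
Definition closure_system (T : finType) (C : {set {set T}}) : Prop :=
  [set: T] \in C /\
  forall F : {set {set T}}, F \subset C -> \bigcap_(A in F) A \in C.

Definition semi_interval_system (T : finType) (I : {set {set T}}) : Prop :=
  [/\ closure_system I,
      set0 \in I,
      forall x : T, [set x] \in I
    & {in I &, forall A B : {set T}, A :&: B != set0 -> A :|: B \in I}].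

Definition partitions_into (T : finType) (I : {set {set T}}) : {set part T} :=
  [set P : part T | blocks P \subset I].

(* Main.v *)
(** A boolean sublattice with atom [c] satisfies
    #{Q <= P} <= 2 #{Q <= c'} for the complement [c'] of [c] below [P], while [c']
    has at least one block more than [P].  Descending along such steps,
    #{Q <= P} * 2^(number of blocks of P) <= 2 * 2^(number of blocks of b) for any
    atom [b] below [P]; the point is that [b] can be removed last.  The partitions
    with at most one nontrivial block, which contains a fixed point [v0], form a
    boolean sublattice of size 2^(|V|-1) (the subforests of a star).  Hence a
    largest boolean sublattice [B] contains the discrete and the one-block
    partitions, and each of its atoms merges just two points (the atoms are the
    edges of a tree).  The semi-intervals are the sets [A] such that the partition
    whose only nontrivial block is [A] lies in [B]. *)

Require Import Defs.
From mathcomp Require Import all_boot all_order.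

Set Implicit Arguments.
Unset Strict Implicit.
Unset Printing Implicit Defensive.

Import Order.TTheory.

(** * Partitions through their same-block relation; counting blocks *)

Section Partitions.
Local Open Scope order_scope.
Variable T : finType.
Implicit Types (P Q R : part T) (A C : {set T}) (x y : T).

Lemma same_block_refl P x : same_block P x x.
Proof. by have [] := same_block_equiv P x x x. Qed.

Lemma same_block_trans P : transitive (same_block P).
Proof. by move=> y x z xy; have [_ /(_ xy)->] := same_block_equiv P x y z. Qed.

Lemma part_leP P Q :
  reflect (forall x y, same_block P x y -> same_block Q x y) (P <= Q).
Proof. exact: refinesP. Qed.

Lemma part_eqP P Q : same_block P =2 same_block Q -> P = Q.
Proof. by move=> eqPQ; apply/le_anti/andP; split; apply/part_leP=> x y; rewrite eqPQ. Qed.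

Lemma same_block_meet P Q x y :
  same_block (P `&` Q) x y = same_block P x y && same_block Q x y.
Proof. exact: same_block_classes. Qed.

Lemma pblock_blocks P x : pblock (blocks P) x \in blocks P.
Proof.
by have /and3P[/eqP covP _ _] := valP P; rewrite pblock_mem // covP inE.
Qed.

Lemma in_pblock P x : x \in pblock (blocks P) x.
Proof. exact: same_block_refl. Qed.

Lemma blocksP P A : A \in blocks P -> exists x, A = pblock (blocks P) x.
Proof.
have /and3P[_ triP P0] := valP P.
move=> PA; have /set0Pn[x Ax] : A != set0 by apply: contraNneq P0 => <-.
by exists x; rewrite (def_pblock triP PA Ax).
Qed.

(* The chosen representatives of the blocks: their number is that of blocks. *)
Definition roots P : {set T} :=
  [set x | [forall y, same_block P x y ==> (enum_rank x <= enum_rank y)%N]].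

Lemma rootsP P x :
  reflect (forall y, same_block P x y -> (enum_rank x <= enum_rank y)%N)
          (x \in roots P).
Proof. by rewrite inE; apply: (iffP forall_inP). Qed.

Lemma ex_root P x : exists2 y, y \in roots P & same_block P x y.
Proof.
case: (arg_minnP (fun y => enum_rank y : nat) (same_block_refl P x)) => y xy ymin.
by exists y => //; apply/rootsP=> z yz; apply: ymin (same_block_trans xy yz).
Qed.

(** A root of [Q] is minimal in a larger class, so it is a root of [P]. If the counts agreed, the
    root sets would coincide, so [Q]-related points would have the same root in [P], giving
    [Q <= P]. *)
Lemma roots_lt P Q : P < Q -> (#|roots Q| < #|roots P|)%N.
Proof.
rewrite lt_neqAle => /andP[neqPQ lePQ]; have /part_leP sPQ := lePQ.
have sQP : roots Q \subset roots P.
  by apply/subsetP=> x /rootsP Qx; apply/rootsP=> y /sPQ/Qx.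
rewrite ltn_neqAle subset_leq_card // andbT; apply: contraNN neqPQ => eqc.
have /eqP eqR : roots Q == roots P by rewrite eqEcard sQP -(eqP eqc) leqnn.
apply/eqP/le_anti; rewrite lePQ /=; apply/part_leP=> x y Qxy.
have [u Pu xu] := ex_root P x; have [v Pv yv] := ex_root P y.
have Quv : same_block Q u v.
  rewrite (same_block_trans _ (sPQ _ _ yv)) // (same_block_trans _ Qxy) //.
  by rewrite same_block_sym sPQ.
have eq_uv : u = v.
  move: Pu Pv; rewrite -eqR => /rootsP/(_ _ Quv) le_uv.
  rewrite same_block_sym in Quv; move=> /rootsP/(_ _ Quv) le_vu.
  by apply/enum_rank_inj/val_inj/eqP; rewrite /= eqn_leq le_uv le_vu.
by rewrite (same_block_trans xu) // eq_uv same_block_sym.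
Qed.

Lemma part_ind (K : part T -> Prop) :
  (forall P, (forall Q, Q < P -> K Q) -> K P) -> forall P, K P.
Proof.
move=> KP P; have [n] := ubnP (#|T| - #|roots P|)%N.
elim: n P => // n IHn P ltPn; apply: KP => Q ltQP; apply: IHn.
have ltPQ := roots_lt ltQP.
rewrite -ltnS; apply: leq_trans ltPn; rewrite ltnS ltn_sub2l //.
by rewrite (leq_trans ltPQ) ?max_card.
Qed.

(** * Partitions with at most one nontrivial block *)

Definition single_rel A : rel T := fun x y => (x == y) || (x \in A) && (y \in A).

Lemma single_rel_equiv A : equivalence_rel (single_rel A).
Proof.
rewrite /single_rel => x y z; rewrite eqxx; split=> // /orP[/eqP->//|/andP[Ax Ay]].
rewrite Ax Ay /=; case: (boolP (z \in A)) => [|Az]; rewrite ?orbT // !orbF.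
by rewrite (negPf (memPn Az _ Ax)) (negPf (memPn Az _ Ay)).
Qed.

Definition single A : part T := classes_of (single_rel_equiv A).

Lemma same_block_single A x y :
  same_block (single A) x y = (x == y) || (x \in A) && (y \in A).
Proof. exact: same_block_classes. Qed.

Lemma single_leP A P :
  reflect {in A &, forall x y, same_block P x y} (single A <= P).
Proof.
apply: (iffP (part_leP _ _)) => [sAP x y Ax Ay | sAP x y].
  by apply: sAP; rewrite same_block_single Ax Ay orbT.
rewrite same_block_single => /orP[/eqP->|/andP[]]; last exact: sAP.
exact: same_block_refl.
Qed.

Lemma single_leS A C : A \subset C -> single A <= single C.
Proof.
move=> /subsetP sAC; apply/single_leP=> x y /sAC Cx /sAC Cy.
by rewrite same_block_single Cx Cy orbT.
Qed.

Lemma single0_le P : single set0 <= P.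
Proof. by apply/single_leP=> x y; rewrite inE. Qed.

Lemma single_sub1 x A : A \subset [set x] -> single A = single set0.
Proof.
move=> /subsetP sAx; apply/le_anti; rewrite single0_le andbT.
by apply/single_leP=> y z /sAx/set1P-> /sAx/set1P->; apply: same_block_refl.
Qed.

Lemma le_singleT P : P <= single setT.
Proof. by apply/part_leP=> x y _; rewrite same_block_single !inE orbT. Qed.

Lemma singleI A C : single (A :&: C) = single A `&` single C.
Proof.
apply/part_eqP=> x y; rewrite same_block_meet !same_block_single !inE.
by case: eqP => //= _; rewrite andbACA.
Qed.

(** A common point [z] links all points of [A :|: C] in the join. *)
Lemma singleU A C : A :&: C != set0 -> single (A :|: C) = single A `|` single C.
Proof.
case/set0Pn=> z /setIP[Az Cz]; apply/le_anti/andP; split; last first.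
  by rewrite leUx !single_leS ?subsetUl ?subsetUr.
have to_z x : x \in A :|: C -> same_block (single A `|` single C) x z.
  case/setUP=> [Ax|Cx].
    by apply: (elimT (part_leP (single A) _) (leUl _ _)); rewrite same_block_single Ax Az orbT.
  by apply: (elimT (part_leP (single C) _) (leUr _ _)); rewrite same_block_single Cx Cz orbT.
apply/single_leP=> x y /to_z xz /to_z yz.
by apply: same_block_trans xz _; rewrite same_block_sym.
Qed.

Lemma pblock_single A x :
  pblock (blocks (single A)) x = if x \in A then A else [set x].
Proof.
apply/setP=> y; rewrite -[LHS]/(same_block _ x y) same_block_single.
case: ifP => Ax /=; last by rewrite orbF !inE eq_sym.
by case: eqP => // <-.
Qed.

(* A maximal member of [I] inside a block of [P `|` Q] is a union of blocks of
   [P] and of blocks of [Q]. *)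
Lemma partitions_into_join (I : {set {set T}}) P Q :
    {in I &, forall A C, A :&: C != set0 -> A :|: C \in I} ->
  P \in partitions_into I -> Q \in partitions_into I ->
  P `|` Q \in partitions_into I.
Proof.
move=> IU; rewrite !inE => /subsetP IP /subsetP IQ; apply/subsetP=> _ /blocksP[x ->].
set A := pblock _ x.
pose inA U := [&& U \in I, x \in U & U \subset A].
have block_sub R z : R <= P `|` Q -> z \in A -> pblock (blocks R) z \subset A.
  move=> /part_leP sR Az; apply/subsetP=> y /sR zy.
  exact: (same_block_trans (y := z)) zy.
have inAx : inA (pblock (blocks P) x).
  by rewrite /inA IP ?pblock_blocks // in_pblock block_sub ?leUl ?in_pblock.
have [U /maxsetP[/and3P[IU0 Ux sUA] Umax] _] := maxset_exists inAx.
have closedU R : {subset blocks R <= I} -> R <= P `|` Q ->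
    forall y z, same_block R y z -> y \in U -> z \in U.
  move=> IR leR y z yz Uy.
  (* The block of [y] meets [U] in [y], so its union with [U] stays in [I], and maximality of [U]
     absorbs it. *)
  have <- : U :|: pblock (blocks R) y = U; last by rewrite inE orbC [_ \in _]yz.
  apply: Umax; last exact: subsetUl.
  rewrite /inA inE Ux subUset sUA block_sub ?(subsetP sUA) // !andbT.
  apply: IU => //; first exact: IR (pblock_blocks R y).
  by apply/set0Pn; exists y; rewrite inE Uy in_pblock.
suff -> : A = U by [].
apply/eqP; rewrite eqEsubset sUA andbT; apply/subsetP=> y.
rewrite -[y \in A]/(same_block _ x y).
rewrite [same_block _ _ _]same_block_classes => xy.
rewrite -(closed_connect (a := mem U) _ xy) //.
apply: intro_closed => [|u v /orP[] uv Uu].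
- by apply: sym_connect_sym => u v; rewrite same_block_sym (same_block_sym Q).
- exact: closedU IP (leUl _ _) _ _ uv Uu.
- exact: closedU IQ (leUr _ _) _ _ uv Uu.
Qed.

End Partitions.

(** * Counting in a Boolean sublattice *)

Section BooleanSublattice.
Local Open Scope order_scope.
Variables (T : finType) (B : {set part T}) (bot top : part T).
Hypothesis meetB : {in B &, forall P Q, P `&` Q \in B}.
Hypothesis joinB : {in B &, forall P Q, P `|` Q \in B}.
Hypothesis distrB :
  {in B & &, forall P Q R, P `&` (Q `|` R) = (P `&` Q) `|` (P `&` R)}.
Hypotheses (botB : bot \in B) (topB : top \in B).
Hypothesis boundB : {in B, forall P, bot <= P <= top}.
Hypothesis complB :
  {in B, forall P, exists2 Q, Q \in B & P `&` Q = bot /\ P `|` Q = top}.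
Implicit Types P Q b c : part T.

Definition atomB c : Prop :=
  [/\ c \in B, c != bot & {in B, forall Q, Q <= c -> Q = bot \/ Q = c}].

Definition belowB P : {set part T} := [set Q in B | Q <= P].

Lemma ex_atomB P : P \in B -> P != bot -> exists2 c, atomB c & c <= P.
Proof.
elim/part_ind: P => P IH PB Pbot.
have [/exists_inP[Q QB /andP[Qbot ltQP]]|noQ] :=
    boolP [exists Q in B, (Q != bot) && (Q < P)].
  by have [c ac leQ] := IH Q ltQP QB Qbot; exists c; rewrite // (le_trans leQ) // ltW.
exists P => //; split=> // Q QB leQP.
have [|Qbot] := eqVneq Q bot; [by left | right].
apply: contraNeq noQ => neqQP; apply/exists_inP; exists Q => //.
by rewrite Qbot lt_neqAle neqQP.
Qed.

(** Cut the complement of [c] in [B] down to [P]; distributivity gives back [P] as the join. *)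
Lemma rel_complB P c : P \in B -> c \in B -> c <= P ->
  exists2 c', c' \in B & c `&` c' = bot /\ c `|` c' = P.
Proof.
move=> PB cB lecP; have [Q QB [cQ0 cQ1]] := complB cB.
exists (P `&` Q); first exact: meetB.
split; first by rewrite meetCA cQ0; apply/meet_r; case/andP: (boundB PB).
have /andP[_ lePt] := boundB PB.
by rewrite -[c in LHS](meet_r lecP) -distrB // cQ1; apply/meet_l.
Qed.

(** By distributivity, [Q] is the join of its meets with [c] and [c']. The first is [bot] or [c], so
    one bit and a member below [c'] determine [Q]. *)
Lemma card_belowB P c c' : atomB c -> P \in B -> c' \in B -> c `|` c' = P ->
  (#|belowB P| <= 2 * #|belowB c'|)%N.
Proof.
move=> [cB cbot cmin] PB c'B eqP.
pose f Q := (c <= Q, Q `&` c').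
have f_inj : {in belowB P &, injective f}.
  move=> Q R; rewrite !inE => /andP[QB leQP] /andP[RB leRP] eqf.
  have eqc : (c <= Q) = (c <= R) := congr1 fst eqf.
  have eqc' : Q `&` c' = R `&` c' := congr1 snd eqf.
  have cutE S : S \in B -> S <= P -> S = (S `&` c) `|` (S `&` c').
    by move=> SB leSP; rewrite -distrB // eqP; apply/esym/meet_l.
  have cutc S : S \in B -> S `&` c = if c <= S then c else bot.
    move=> SB; case: ifP => [/meet_r //|ncS].
    have [//|Sc] := cmin _ (meetB SB cB) (leIr _ _).
    by rewrite -Sc leIl in ncS.
  by rewrite (cutE Q) // (cutE R) // !cutc // eqc eqc'.
rewrite -(card_in_imset f_inj) -card_bool -cardsT -cardsX.
apply/subset_leq_card/subsetP=> _ /imsetP[Q /setIdP[QB leQP] ->].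
by rewrite !inE /= meetB ?leIr.
Qed.

(** Each descent from [P] to the complement [c'] of an atom costs a factor 2, repaid by the
    additional root of [c']. *)
Lemma card_belowB_atom P b : P \in B -> atomB b -> b <= P ->
  (#|belowB P| * 2 ^ #|roots P| <= 2 * 2 ^ #|roots b|)%N.
Proof.
elim/part_ind: P => P IH PB ab lebP; have [bB bbot bmin] := ab.
have [<-|neqbP] := eqVneq b P.
  rewrite leq_mul2r; apply/orP; right.
  apply: leq_trans (_ : (#|[set bot; b]| <= _)%N); last by rewrite cards2; case: eqP.
  apply/subset_leq_card/subsetP=> Q /setIdP[QB /(bmin _ QB)].
  by rewrite !inE => -[->|->]; rewrite eqxx ?orbT.
have [b' b'B [bb'0 bb'1]] := rel_complB PB bB lebP.
have leb'P : b' <= P by rewrite -bb'1 leUr.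
have b'bot : b' != bot.
  apply: contraNneq neqbP => eqb'; rewrite -bb'1 eqb'.
  by apply/eqP/esym/join_l; case/andP: (boundB bB).
(* Choosing [c] below the complement of [b] makes it disjoint from [b], so [b] remains below [c']
   and the induction hypothesis applies. *)
have [c ac lecb'] := ex_atomB b'B b'bot; have [cB cbot cmin] := ac.
have lecP := le_trans lecb' leb'P.
have [c' c'B [cc'0 cc'1]] := rel_complB PB cB lecP.
have bc0 : b `&` c = bot.
  apply/le_anti; have /andP[-> _] := boundB (meetB bB cB).
  by rewrite andbT -bb'0 leI2.
have lebc' : b <= c'.
  rewrite -[X in X <= _](meet_l lebP) -cc'1 distrB // bc0.
  by rewrite leUx leIr andbT; case/andP: (boundB c'B).
have ltc'P : c' < P.
  rewrite lt_neqAle -{2}cc'1 leUr andbT; apply: contraNneq cbot => eqc'.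
  by rewrite -cc'0 eqc' (meet_l lecP).
apply: leq_trans (IH c' ltc'P c'B ab lebc').
apply: leq_trans (_ : (2 * #|belowB c'| * 2 ^ #|roots P| <= _)%N).
  by rewrite leq_mul2r (card_belowB ac PB c'B cc'1) orbT.
rewrite mulnAC mulnC leq_mul2l -expnS leq_exp2l // roots_lt //.
by rewrite orbT.
Qed.

(** An atom has fewer roots than [bot], which absorbs the factor 2 of [card_belowB_atom]. *)
Lemma card_belowB_bot P : P \in B ->
  (#|belowB P| * 2 ^ #|roots P| <= 2 ^ #|roots bot|)%N.
Proof.
move=> PB; have [->|Pbot] := eqVneq P bot.
  rewrite -[leqRHS]mul1n leq_mul2r -(cards1 bot) subset_leq_card ?orbT //.
  apply/subsetP=> Q /setIdP[QB leQ]; rewrite inE; apply/eqP/le_anti.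
  by rewrite leQ; case/andP: (boundB QB).
have [c ac lecP] := ex_atomB PB Pbot; have [cB cbot _] := ac.
apply: leq_trans (card_belowB_atom PB ac lecP) _.
rewrite -expnS leq_exp2l // roots_lt // lt_neqAle eq_sym cbot.
by case/andP: (boundB cB).
Qed.

Lemma belowB_top : belowB top = B.
Proof.
apply/setP=> Q; rewrite inE andb_idr // => QB.
by case/andP: (boundB QB).
Qed.

(** * Boolean sublattices at least as large as a star *)

Hypotheses (T_gt0 : (0 < #|T|)%N) (cardB : (2 ^ #|T|.-1 <= #|B|)%N).

Lemma roots_top_bot : (#|T|.-1 + #|roots top| <= #|roots bot|)%N.
Proof.
rewrite -(leq_exp2l (m := 2)) // expnD.
by apply: leq_trans (card_belowB_bot topB); rewrite belowB_top leq_mul2r cardB orbT.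
Qed.

Lemma roots_gt0 P : (0 < #|roots P|)%N.
Proof.
have /card_gt0P[x _] := T_gt0; have [y Py _] := ex_root P x.
by apply/card_gt0P; exists y.
Qed.

(** As [top] has a root, [bot] has at least [#|T|] of them; a strictly finer partition would have
    too many. *)
Lemma botE : bot = single set0.
Proof.
apply/eqP; rewrite eq_sym; apply: contraTT (max_card (mem (roots (single set0)))).
move=> neq; rewrite -ltnNge.
apply: leq_ltn_trans (roots_lt (_ : single set0 < bot)); last first.
  by rewrite lt_neqAle neq single0_le.
apply: leq_trans roots_top_bot; rewrite -{1}(prednK T_gt0) -addn1 leq_add2l.
exact: roots_gt0.
Qed.

(** As [bot] has at most [#|T|] roots, [top] has at most one. *)
Lemma topE : top = single setT.
Proof.
apply/eqP; apply: contraTT (roots_gt0 (single setT)) => neq; rewrite -leqNgt.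
have ltT : top < single setT by rewrite lt_neqAle neq le_singleT.
rewrite -ltnS; apply: leq_trans (roots_lt ltT) _.
rewrite -(leq_add2l #|T|.-1) addn1 prednK //.
exact: leq_trans roots_top_bot (max_card _).
Qed.

(** The counting bound at [top] leaves [c] at least [#|T| - 1] roots. If [c] did more than merge two
    points, a chain [bot < e < c] in the full partition lattice would leave it at most
    [#|T| - 2]. *)
Lemma atomBE c : atomB c -> exists x y, c = single [set x; y].
Proof.
move=> ac; have [cB cbot _] := ac; have /andP[lebc lect] := boundB cB.
have nle : ~~ (c <= bot) by apply: contraNN cbot => lecb; rewrite eq_le lecb.
have /existsP[x /existsP[y /andP[xy nxy]]] :
    [exists x, exists y, same_block c x y && (x != y)].
  apply: contraNT nle => /existsPn no_xy; apply/part_leP=> x y cxy.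
  have /existsPn/(_ y) := no_xy x; rewrite cxy negbK => /eqP->.
  exact: same_block_refl.
exists x, y; apply/eqP; rewrite eq_sym; set e := single _.
have lee : e <= c.
  apply/single_leP=> u v /set2P[]-> /set2P[]-> //; rewrite ?same_block_refl //.
  by rewrite same_block_sym.
have lt0e : bot < e.
  rewrite lt_neqAle botE single0_le andbT; apply: contraNneq nxy => eq0.
  have := same_block_single [set x; y] x y.
  by rewrite -/e -eq0 same_block_single !inE !eqxx !orbT => /orP[|/andP[]].
apply: contraT => neq; have ltec : e < c by rewrite lt_neqAle neq.
have := card_belowB_atom topB ac lect; rewrite belowB_top leqNgt => /negP[].
apply: leq_trans (_ : (2 ^ #|T|.-1 * 2 ^ #|roots top| <= _)%N); last first.
  by rewrite leq_mul2r cardB orbT.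
rewrite -expnD -expnS ltn_exp2l //.
apply: leq_ltn_trans (roots_lt ltec) _.
apply: leq_trans (roots_lt lt0e) _; apply: leq_trans (max_card _) _.
by rewrite -{1}(prednK T_gt0) -addn1 leq_add2l roots_gt0.
Qed.

(** * The semi-intervals of the sublattice *)

Definition semi_intervals : {set {set T}} := [set A | single A \in B].

Lemma semi_intervalsU :
  {in semi_intervals &, forall A C, A :&: C != set0 -> A :|: C \in semi_intervals}.
Proof. by move=> A C; rewrite !inE => BA BC AC; rewrite singleU // joinB. Qed.

Lemma semi_intervals_sub1 x (A : {set T}) : A \subset [set x] -> A \in semi_intervals.
Proof. by rewrite inE => /single_sub1->; rewrite -botE. Qed.

Lemma semi_intervals_system : semi_interval_system semi_intervals.
Proof.
have setT_I : [set: T] \in semi_intervals by rewrite inE -topE.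
split=> [||x|]; last exact: semi_intervalsU.
- split=> // F /subsetP FI.
  apply: (big_ind (fun A => A \in semi_intervals)) => // A C.
  by rewrite !inE singleI; apply: meetB.
- by rewrite inE -botE.
- exact: semi_intervals_sub1 (subxx _).
Qed.

Lemma single_into (A : {set T}) :
  A \in semi_intervals -> single A \in partitions_into semi_intervals.
Proof.
move=> IA; rewrite inE; apply/subsetP=> _ /blocksP[x ->].
by rewrite pblock_single; case: ifP => // _; apply: semi_intervals_sub1 (subxx _).
Qed.

(** Induction: [P] is the join of an atom, which is a [single] by [atomBE], and a smaller member;
    (I1) makes the target closed under joins. *)
Lemma B_sub_partitions_into P : P \in B -> P \in partitions_into semi_intervals.
Proof.
elim/part_ind: P => P IH PB; have [->|Pbot] := eqVneq P bot.
  by rewrite botE single_into // inE -botE.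
have [c ac lecP] := ex_atomB PB Pbot; have [cB cbot _] := ac.
have [c' c'B [cc'0 cc'1]] := rel_complB PB cB lecP.
rewrite -cc'1; apply: partitions_into_join; first exact: semi_intervalsU.
  have [x [y eqc]] := atomBE ac.
  by rewrite eqc single_into // inE -eqc.
apply: IH => //; rewrite lt_neqAle -{2}cc'1 leUr andbT.
by apply: contraNneq cbot => eqc'; rewrite -cc'0 eqc' (meet_l lecP).
Qed.

(** A member [Q] of [B] below [P] with fewest roots contains every block [A] of [P] in one of its
    own, since otherwise joining [single A] would lower the count. *)
Lemma partitions_into_sub_B P : P \in partitions_into semi_intervals -> P \in B.
Proof.
rewrite inE => /subsetP IP.
have bot0 : (bot \in B) && (bot <= P) by rewrite botB botE single0_le.
case: (arg_minnP (P := fun Q => (Q \in B) && (Q <= P))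
         (fun Q => #|roots Q|) bot0) => Q /andP[QB leQP] Qmin.
suff -> : P = Q by [].
apply/le_anti; rewrite leQP andbT; apply/part_leP=> x y Pxy.
set A := pblock (blocks P) x.
have BA : single A \in B by have := IP _ (pblock_blocks P x); rewrite inE.
have leAP : single A <= P.
  apply/single_leP=> u v xu xv; apply: (same_block_trans (y := x)) xv.
  by rewrite same_block_sym.
have leAQ : single A <= Q.
  apply: contraT => nAQ.
  have ltQ : Q < Q `|` single A.
    by rewrite lt_neqAle leUl andbT; apply: contraNneq nAQ => ->; rewrite leUr.
  have := Qmin (Q `|` single A).
  by rewrite joinB // leUx leQP leAP leqNgt roots_lt // => /(_ isT).
by apply: (elimT (single_leP _ _) leAQ); rewrite ?in_pblock.
Qed.

End BooleanSublattice.

(** * The star sublattice and its size *)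

Section Star.
Local Open Scope order_scope.
Variables (T : finType) (v0 : T).
Implicit Types A C : {set T}.

Definition star : {set part T} :=
  [set single (v0 |: A) | A in powerset [set~ v0]].

Lemma single_star A : v0 \in A -> single A \in star.
Proof.
move=> Av0; apply/imsetP; exists (A :\ v0); last by rewrite setD1K.
by rewrite inE subsetDr.
Qed.

Lemma starP P : P \in star -> exists2 A : {set T}, v0 \in A & P = single A.
Proof. by case/imsetP=> A _ ->; exists (v0 |: A); rewrite // setU11. Qed.

Lemma card_star : #|star| = (2 ^ #|T|.-1)%N.
Proof.
rewrite card_in_imset ?card_powerset ?cardsC1 // => A C.
rewrite !inE => /subsetP sA /subsetP sC eqAC; apply/setP=> x.
have [->|nx] := eqVneq x v0.
  by apply/idP/idP=> [/sA|/sC]; rewrite !inE eqxx.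
have := same_block_single (v0 |: A) v0 x; rewrite eqAC same_block_single.
by rewrite !inE eqxx eq_sym (negPf nx) /= => ->.
Qed.

(** On sets containing [v0], [single] carries intersection and union to meet and join. *)
Lemma star_boolean : boolean_sublattice star.
Proof.
have meet2 A C : v0 \in A -> v0 \in C -> v0 \in A :&: C by rewrite inE => -> ->.
have joinE A C : v0 \in A -> v0 \in C -> single A `|` single C = single (A :|: C).
  by move=> Av0 Cv0; rewrite singleU //; apply/set0Pn; exists v0; apply: meet2.
split.
- by move=> _ _ /starP[A Av0 ->] /starP[C Cv0 ->]; rewrite -singleI single_star ?meet2.
- move=> _ _ /starP[A Av0 ->] /starP[C Cv0 ->].
  by rewrite joinE // single_star // inE Av0.
- move=> _ _ _ /starP[A Av0 ->] /starP[C Cv0 ->] /starP[D Dv0 ->].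
  by rewrite joinE // -!singleI joinE ?meet2 // setIUr.
exists (single [set v0]), (single setT); split.
- by rewrite single_star ?set11.
- by rewrite single_star ?inE.
- by move=> _ /starP[A Av0 ->]; rewrite le_singleT single_leS // sub1set.
(* The bottom is [single [set v0]], so the set complement gets [v0] back. *)
move=> _ /starP[A Av0 ->]; exists (single (v0 |: ~: A)).
  by rewrite single_star ?setU11.
rewrite -singleI joinE ?setU11 //; split; congr single; apply/setP=> x; rewrite !inE.
  by have [->|_] := eqVneq x v0; rewrite ?Av0 ?andbN.
by rewrite orbCA orbN orbT.
Qed.

End Star.

Theorem corollary1p5 (V : finType) (hV : 3 <= #|V|)
  (B : {set part V}) (hB : largest_boolean_sublattice B) :
  exists I : {set {set V}},
    semi_interval_system I /\ B = partitions_into I.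
Proof.
case: hB => -[meetB joinB distrB [bot [top [botB topB boundB complB]]]] maxB.
have V_gt0 : 0 < #|V| by apply: leq_trans hV.
have /card_gt0P[v0 _] := V_gt0.
have cardB : 2 ^ #|V|.-1 <= #|B|.
  (* The star at an arbitrary point is a competitor for the largest size. *)
  by rewrite -(card_star v0); apply/maxB/star_boolean.
exists (semi_intervals B); split.
  exact: (semi_intervals_system (bot := bot) (top := top)).
apply/setP=> P; apply/idP/idP.
  exact: (B_sub_partitions_into (bot := bot) (top := top)).
exact: (partitions_into_sub_B (bot := bot) (top := top)).
Qed.
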